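(* Let $K$ be a field of characteristic different from $2$ with $K=K(\varepsilon_2)$, let $G=\langle g\rangle$ be a cyclic group of order $2^n$, and let $K_tG$ be the twisted group algebra of $G$ over $K$ defined by $\bar g^{2^n}=a\in K^*$. Let $H_n(a)=s$ and write $a=b^{2^s}$ with $b\in K^*$. Then the minimal idempotents of $K_tG$ are precisely the following. 1) If at least one of the following conditions holds: (a) $K$ is of type A; (b) $K$ is of type B and $0\le s\le m$, where $m$ is the constant of $K$; then the minimal idempotents are $$e_i=\frac1{2^s}\sum_{j=0}^{2^s-1}\left(b^{-1}\varepsilon_s^{-i}\,\bar g^{\,2^{n-s}}\right)^j,\qquad i=0,1,2,\ldots,2^s-1.$$ 2) If $K$ is of type B and $m<s\le n$, then the minimal idempotents are $$e_i=\frac1{2^s}\sum_{j=0}^{2^s-1}\left(b^{-1}\varepsilon_m^{-i}\,\bar g^{\,2^{n-s}}\right)^j,\qquad i=0,1,2,\ldots,2^m-1,$$ together with $$e_{ri}=\frac1{2^{s-r}}\sum_{j=0}^{2^{s-r}-1}\left(b^{-2^r}\varepsilon_m^{-1}\varepsilon_{m-1}^{-i}\,\bar g^{\,2^{n-s+r}}\right)^j,\qquad r=1,2,\ldots,s-m,\quad i=0,1,2,\ldots,2^{m-1}-1.$$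
   Context: For each integer $k\ge 0$, $\varepsilon_k$ denotes a primitive $2^k$-th root of $1$ in a fixed algebraic closure $\bar K$ of $K$ (so $\varepsilon_0=1$, $\varepsilon_1=-1$). $K^*$ is the multiplicative group of $K$. Types. A field $K$ with $K=K(\varepsilon_2)$ is of type A if $\varepsilon_k\in K$ for every natural $k$; it is of type B if there is a natural number $m\ge 2$ (necessarily unique) with $\varepsilon_m\in K$ and $\varepsilon_{m+1}\notin K$; this $m$ is called the constant of $K$ (with respect to $2$). Twisted group algebra. A twisted group algebra $K_tG$ of a group $G$ over $K$ is an associative $K$-algebra with $K$-basis $\{\bar x\mid x\in G\}$ and multiplication $\bar x\,\bar y=\gamma(x,y)\overline{xy}$, $\gamma(x,y)\in K^*$. If $G=\langle g\rangle$ is cyclic of order $2^n$, then $\bar g^{2^n}=a$ (meaning $a$ times the identity) for some $a\in K^*$, and this equality determines $K_tG$ (it is the commutative algebra $K[x]/(x^{2^n}-a)$ with $x\mapsto\bar g$); we say that the equality defines $K_tG$. Height. For an integer $s\ge 0$ let $K_s=K^*\cap (K(\varepsilon_2)^* )^{2^s}$, where $(F^* )^{2^s}=\{u^{2^s}\mid u\in F^*\}$; when $K=K(\varepsilon_2)$ this is $(K^* )^{2^s}$. $H_n(a)$ denotes the greatest integer $s\in[0,n]$ such that $a\in K_s$. A minimal idempotent of a commutative algebra is a nonzero idempotent that is not a sum of two nonzero orthogonal idempotents. *)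

(* Defs.v *)
From HB Require Import structures.
From mathcomp Require Import all_boot all_order all_algebra all_fingroup all_field.

Set Implicit Arguments.
Unset Strict Implicit.
Unset Printing Implicit Defensive.

Import GRing.Theory.
Local Open Scope ring_scope.

(* The embedding iota : K -> L presents L as an algebraic closure of K, once L
   is a closedFieldType. *)
Definition algebraic_over (K L : fieldType) (iota : {rmorphism K -> L}) : Prop :=
  forall u : L, algebraicOver iota u.

Definition in_base (K L : fieldType) (iota : {rmorphism K -> L}) (x : L) : Prop :=
  exists c : K, iota c = x.

Record is_subfield (L : fieldType) (S : L -> Prop) : Prop := IsSubfield {
  subfield_1 : S 1;
  subfield_sub : forall x y, S x -> S y -> S (x - y);
  subfield_div : forall x y, S x -> S y -> S (x / y) }.

(* K(z): the intersection of the subfields of L containing K and z. *)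
Definition adjoin (K L : fieldType) (iota : {rmorphism K -> L}) (z x : L) : Prop :=
  forall S : L -> Prop,
    is_subfield S -> (forall c : K, S (iota c)) -> S z -> S x.

Definition eps_system (L : fieldType) (eps : nat -> L) : Prop :=
  forall k : nat, (2 ^ k).-primitive_root (eps k).

Definition base_eq_adjoin2 (K L : fieldType) (iota : {rmorphism K -> L})
    (eps : nat -> L) : Prop :=
  forall x : L, in_base iota x <-> adjoin iota (eps 2) x.

Definition type_A (K L : fieldType) (iota : {rmorphism K -> L})
    (eps : nat -> L) : Prop :=
  forall k : nat, in_base iota (eps k).

Definition type_B (K L : fieldType) (iota : {rmorphism K -> L})
    (eps : nat -> L) (m : nat) : Prop :=
  [/\ (2 <= m)%N, in_base iota (eps m) & ~ in_base iota (eps m.+1)].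

(* K_s = K^* \cap (K(eps_2)^* )^(2^s) *)
Definition in_Ks (K L : fieldType) (iota : {rmorphism K -> L})
    (eps : nat -> L) (s : nat) (a : K) : Prop :=
  a != 0 /\
  exists u : L, [/\ adjoin iota (eps 2) u, u != 0 & iota a = u ^+ (2 ^ s)].

(* H_n(a) = s *)
Definition is_height (K L : fieldType) (iota : {rmorphism K -> L})
    (eps : nat -> L) (n : nat) (a : K) (s : nat) : Prop :=
  [/\ (s <= n)%N, in_Ks iota eps s a &
      forall t : nat, (t <= n)%N -> in_Ks iota eps t a -> (t <= s)%N].

(* Only the values of bar and gamma on G are meaningful. Linear independence of
   the family indexed by G makes bar injective on G. *)
Record is_twisted_group_algebra (K : fieldType) (gT : finGroupType)
    (G : {group gT}) (A : falgType K) (bar : gT -> A) (gamma : gT -> gT -> K) :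
    Prop := IsTwistedGroupAlgebra {
  tga_basis : basis_of fullv [seq bar x | x : gT in G];
  tga_cocycle_neq0 : forall x y, x \in G -> y \in G -> gamma x y != 0;
  tga_mul : forall x y, x \in G -> y \in G ->
    bar x * bar y = gamma x y *: bar (x * y)%g }.

Definition idempotent (A : nzRingType) (e : A) : Prop := e * e = e.

Definition minimal_idempotent (A : nzRingType) (e : A) : Prop :=
  [/\ idempotent e, e != 0 &
      ~ exists f h : A,
          [/\ idempotent f /\ idempotent h, f != 0 /\ h != 0,
              f * h = 0 /\ h * f = 0 & e = f + h]].

(* Main.v *)
Require Import Defs.
From mathcomp Require Import all_boot all_order all_algebra all_fingroup all_field zify.
Import GRing.Theory.
Local Open Scope ring_scope.

Set Implicit Arguments.
Unset Strict Implicit.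
Unset Printing Implicit Defensive.

(** Write x for the image of g.  The powers of x up to exponent 2^n - 1 form a
    basis of the algebra ([tga_power_basis]), which is therefore
    K[X] / (X^(2^n) - a).  Its minimal idempotents correspond to the irreducible
    factors of X^(2^n) - a.

    If k + l = n and c^(2^l) = a, then X^(2^k) - c divides X^(2^n) - a.  In the
    quotient by this factor, u = c^-1 x^(2^k) becomes 1, and in the quotient by
    the cofactor the sum of the 2^l powers of u becomes 0.  So the mean of these
    powers is the idempotent of that factor, and it is minimal as soon as the
    factor is irreducible ([mean_powers_minimal]).

    Since -1 is a square in K, X^(2^k) - c is irreducible whenever c is not a
    square or k = 0 ([irreducible_Xn2subC]).  Two reasons prevent the constants c
    of the theorem from being squares:
    - if c^(2^s) = a with s < n, a square root of c would make a a 2^(s+1)-th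
      power, against the maximality in the height ([height_root_nonsquare]);
    - for r >= 1 and a primitive 2^m-th root of unity z, a square root of
      b^(2^r) z would give one of z, hence a primitive 2^(m+1)-th root of unity
      in K ([base_root_nonsquare]).

    It remains to see that no minimal idempotent is missing.  In a commutative
    ring, a family of minimal idempotents whose sum is 1 contains all of them
    ([minimal_idempotentsE]).  Put u = b^-1 x^(2^(n-s)), so that u^(2^s) = 1.
    Summing over the 2^s-th roots of unity gives 1 at once when they are in K
    ([sum_mean_powers]).  When m < s, summing over the 2^m-th roots of unity
    merges the means of the first kind into the mean of the powers of
    Y = u^(2^m), which is the idempotent of the factor Y - 1 of
    Y^(2^t) - 1 = (Y - 1) (Y + 1) (Y^2 + 1) ... (Y^(2^(t-1)) + 1), t = s - m.
    The idempotents of all these factors have sum 1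
    ([sum_mean_powers_tower]), and each factor Y^(2^i) + 1 is split over the
    2^(m-1)-th roots of unity into the idempotents of the second kind. *)

(** * Irreducibility of binomials of degree a power of 2 *)

Lemma comp_polyX2_reflect (K : fieldType) (p : {poly K}) :
  (p \Po 'X^2) \Po (- 'X) = p \Po 'X^2.
Proof. by rewrite -comp_polyA comp_Xn_poly sqrrN. Qed.

Lemma even_poly_eq (K : fieldType) (q : {poly K}) :
  2%:R != 0 :> K -> q \Po (- 'X) = q -> q = even_poly q \Po 'X^2.
Proof.
move=> two_neq0; rewrite -{1 2 3}[q]poly_even_odd comp_polyD comp_polyM.
rewrite !comp_polyX2_reflect comp_polyX mulrN => /addrI/eqP.
rewrite eq_sym -addr_eq0 -mulr2n -mulr_natl -polyC_natr mulf_eq0 polyC_eq0.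
rewrite (negPf two_neq0) /= => /eqP odd0.
by rewrite odd0 addr0.
Qed.

Lemma dvdp_comp_polyX2 (K : fieldType) (p q : {poly K}) :
  (p \Po 'X^2 %| q \Po 'X^2) = (p %| q).
Proof.
have sX2 : (1 < size ('X^2 : {poly K}))%N by rewrite size_polyXn.
have [->|p0] := eqVneq p 0.
  by rewrite comp_poly0 !dvd0p comp_poly_eq0.
apply/idP/idP; last exact: dvdp_comp_poly.
rewrite {1}(divp_eq q p) comp_polyD comp_polyM.
rewrite dvdp_addr ?dvdp_mulIr // => dvd_r.
rewrite /dvdp -(comp_poly_eq0 _ sX2); apply: contraLR dvd_r => r0.
have pX2_neq0 : p \Po 'X^2 != 0 by rewrite comp_poly_eq0.
rewrite gtNdvdp // (polySpred r0) (polySpred pX2_neq0).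
rewrite !size_comp_poly size_polyXn ltnS ltn_pmul2r // -ltnS.
by rewrite -!polySpred ?ltn_modpN0 // -(comp_poly_eq0 _ sX2).
Qed.

(** Suppose that p(X^2) has a nontrivial factor q.  The gcd of q(X) and q(-X) is
    an even polynomial, hence of the form r(X^2) with r a divisor of p; as p is
    irreducible the gcd is trivial.  Then q(X) q(-X), which is even too, divides
    p(X^2), so it is c p(X^2) for a constant c.  Leading coefficients show that c
    is plus or minus a square, hence a square as -1 is one, and values at 0 show
    that p(0) is a square. *)
Lemma irreducible_comp_polyX2 (K : fieldType) (p : {poly K}) (w : K) :
    2%:R != 0 :> K -> w ^+ 2 = -1 -> p \is monic -> irreducible_poly p ->
    (forall d, p`_0 != d ^+ 2) -> irreducible_poly (p \Po 'X^2).
Proof.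
move=> two_neq0 w2 p_monic [p_gt1 p_irr] p0_nsq.
set f := p \Po 'X^2.
have sX2 : (1 < size ('X^2 : {poly K}))%N by rewrite size_polyXn.
have f0E : f.[0] = p`_0 by rewrite horner_comp hornerXn expr0n horner_coef0.
have f0_neq0 : f.[0] != 0.
  by rewrite f0E; apply: contra (p0_nsq 0) => /eqP->; rewrite expr0n.
have refl0 (q : {poly K}) : (q \Po (- 'X)).[0] = q.[0].
  by rewrite horner_comp hornerN hornerX oppr0.
have p_neq0 := monic_neq0 p_monic.
have f_neq0 : f != 0 by rewrite comp_poly_eq0.
have even_dvd (q : {poly K}) : q \Po (- 'X) = q -> q %| f -> q %= 1 \/ q %= f.
  move=> /(even_poly_eq two_neq0) qE; rewrite qE dvdp_comp_polyX2.
  have [s1 _|s1 /(p_irr _ s1)/andP[dvd1 dvd2]] := eqVneq (size (even_poly q)) 1%N.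
    left; have /eqP/size_poly1P[c c0 ->] := s1.
    by rewrite comp_polyC -size_poly_eq1 size_polyC c0.
  by right; rewrite /eqp !dvdp_comp_poly.
split.
  have f_gt0 : (0 < size f)%N by rewrite size_poly_gt0.
  rewrite -(prednK f_gt0) ltnS size_comp_poly size_polyXn muln_gt0 andbT.
  by rewrite -ltnS prednK // size_poly_gt0.
move=> q q_neq1 q_dvd.
set q' := q \Po (- 'X); set d := gcdp q q'.
have q'_dvd : q' %| f by rewrite -[f]comp_polyX2_reflect dvdp_comp_poly.
have q0_neq0 : q.[0] != 0.
  apply: contra f0_neq0; rewrite -!rootE -!dvdp_XsubCl => /dvdp_trans; exact.
have d_dvd : d %| f := dvdp_trans (dvdp_gcdl _ _) q_dvd.
(* The constant by which d(-X) and d(X) differ is 1: compare values at 0, which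
   are nonzero because d divides f. *)
have d_even : d \Po (- 'X) = d.
  have : d \Po (- 'X) %= d.
    apply: eqp_trans (gcdp_comp_poly _ _ _) _.
    by rewrite -comp_polyA raddfN /= comp_polyX opprK comp_polyXr; exact: gcdpC.
  case/eqpf_eq=> c c0 dE; have := refl0 d; rewrite dE hornerZ => /eqP.
  rewrite -subr_eq0 -{2}[d.[0]]mul1r -mulrBl mulf_eq0 subr_eq0.
  case/orP=> [/eqP->|]; first by rewrite scale1r.
  move=> d0; case/negP: f0_neq0.
  by move: d0; rewrite -!rootE -!dvdp_XsubCl => /dvdp_trans; apply.
have [d1|df] := even_dvd d d_even d_dvd; last first.
  rewrite /eqp q_dvd -(eqp_dvdl _ df); exact: dvdp_gcdl.
have qq'_dvd : q * q' %| f.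
  by rewrite Gauss_dvdp ?q_dvd ?q'_dvd // /coprimep size_poly_eq1.
have qq'_even : (q * q') \Po (- 'X) = q * q'.
  by rewrite comp_polyM -comp_polyA raddfN /= comp_polyX opprK comp_polyXr mulrC.
have [qq'1|] := even_dvd _ qq'_even qq'_dvd.
  case/negP: q_neq1; rewrite -dvdp1 -(eqp_dvdr _ qq'1).
  exact: dvdp_mulIl.
case/eqpf_eq=> c c0 qq'E; exfalso.
have lead_qq' : c = (lead_coef q * w ^+ (size q).-1) ^+ 2.
  have : lead_coef (q * q') = c.
    rewrite qq'E lead_coefZ lead_coef_comp // (monicP p_monic) lead_coefXn.
    by rewrite expr1n !mulr1.
  move=> <-; rewrite lead_coefM lead_coef_comp ?size_polyN ?size_polyX //.
  by rewrite lead_coefN lead_coefX exprMn -exprM mulnC exprM w2 mulrA.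
have q0E : q.[0] ^+ 2 = c * p`_0.
  by rewrite -f0E -hornerZ -qq'E hornerM refl0.
have /negP[] := p0_nsq (q.[0] / (lead_coef q * w ^+ (size q).-1)).
by rewrite expr_div_n q0E -lead_qq' mulrC mulKf.
Qed.

Lemma irreducible_Xn2subC (K : fieldType) (w c : K) (k : nat) :
    2%:R != 0 :> K -> w ^+ 2 = -1 ->
    ((0 < k)%N -> forall d, c != d ^+ 2) ->
  irreducible_poly ('X^(2 ^ k) - c%:P).
Proof.
move=> two_neq0 w2; elim: k => [|k IHk] c_nsq; first exact: irredp_XsubC.
have -> : 'X^(2 ^ k.+1) - c%:P = ('X^(2 ^ k) - c%:P) \Po 'X^2.
  by rewrite comp_polyB comp_Xn_poly comp_polyC -exprM expnS.
have k2 : (0 < 2 ^ k)%N by rewrite expn_gt0.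
apply: (irreducible_comp_polyX2 _ w2) => //; first exact: monicXnsubC.
  by apply: IHk => _; apply: c_nsq.
move=> d; rewrite coefB coefXn coefC /= ltn_eqF // sub0r.
apply: contra (c_nsq isT (w * d)) => /eqP cE.
by rewrite exprMn w2 -cE mulN1r opprK.
Qed.

(** * Means of powers as idempotents *)

Definition mean_powers (K : fieldType) (A : algType K) (M : nat) (u : A) : A :=
  M%:R^-1 *: \sum_(j < M) u ^+ j.

Lemma mulr_mean_powers (K : fieldType) (A : algType K) (M : nat) (u : A) :
  u ^+ M = 1 -> u * mean_powers M u = mean_powers M u.
Proof.
move=> uM; apply/eqP; rewrite -subr_eq0 -[X in _ - X]mul1r -mulrBl.
by rewrite -scalerAr -subrX1 uM subrr scaler0.
Qed.

Lemma mean_powers_idem (K : fieldType) (A : algType K) (M : nat) (u : A) :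
  M%:R != 0 :> K -> u ^+ M = 1 -> Defs.idempotent (mean_powers M u).
Proof.
move=> M_neq0 uM; rewrite /Defs.idempotent {1}/mean_powers -scalerAl mulr_suml.
rewrite (eq_bigr (fun=> mean_powers M u)).
  by rewrite sumr_const card_ord -scaler_nat scalerA mulVf // scale1r.
move=> j _; elim: (j : nat) => [|i IHi]; first by rewrite mul1r.
by rewrite exprSr -mulrA mulr_mean_powers.
Qed.

Lemma sum_root_powers (K : fieldType) (M : nat) (z : K) (j : nat) :
    M.-primitive_root z ->
  \sum_(i < M) (z ^- i) ^+ j = if (M %| j)%N then M%:R else 0.
Proof.
move=> z_prim; have M_gt0 := prim_order_gt0 z_prim.
rewrite (eq_bigr (fun i : 'I_M => (z ^- j) ^+ i)); last first.
  by move=> i _; rewrite !exprVn -!exprM mulnC.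
rewrite (prim_order_dvd z_prim); case: ifPn => [/eqP->|ndvd].
  rewrite invr1 (eq_bigr (fun=> 1)) => [|i _]; last by rewrite expr1n.
  by rewrite sumr_const card_ord.
have /eqP := subrX1 (z ^- j) M.
rewrite exprVn -exprM mulnC exprM (prim_expr_order z_prim) expr1n invr1 subrr.
by rewrite eq_sym mulf_eq0 subr_eq0 invr_eq1 (negPf ndvd) => /eqP.
Qed.

(** Expand all the means and sum over i first: the orthogonality of the powers
    of z kills the exponents that M does not divide. *)
Lemma sum_mean_powers (K : fieldType) (A : algType K) (M L : nat) (z : K) (u : A) :
    M.-primitive_root z ->
  \sum_(i < M) mean_powers (M * L) (z ^- i *: u) = mean_powers L (u ^+ M).
Proof.
move=> z_prim; have M_gt0 := prim_order_gt0 z_prim.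
have M_neq0 : M%:R != 0 :> K := prim_root_natf_neq0 z_prim.
rewrite -scaler_sumr exchange_big /=.
pose F j : A := (if (M %| j)%N then M%:R else 0) *: u ^+ j.
rewrite (eq_bigr (fun j : 'I_(M * L) => F j)) => [|j _]; last first.
  rewrite /F -(sum_root_powers j z_prim) scaler_suml.
  by apply: eq_bigr => i _; rewrite exprZn.
rewrite -(big_mkord predT F) mulnC big_nat_mul big_mkord.
rewrite (eq_bigr (fun k : 'I_L => M%:R *: (u ^+ M) ^+ k)) => [|k _].
  rewrite -scaler_sumr scalerA /mean_powers natrM invfM -mulrA mulVf //.
  by rewrite mulr1.
(* In the block of exponents [k * M, k.+1 * M) only k * M is a multiple of M. *)
rewrite big_ltn ?ltn_pmul2r // big_nat big1.
  by rewrite /= addr0 /F dvdn_mull // mulnC exprM.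
move=> j /andP[lo hi]; rewrite /F ifN ?scale0r //; apply/negP => /dvdnP[q qE].
by move: lo hi; rewrite qE !ltn_pmul2r // ltnS ltnNge => /negPf->.
Qed.

(** The powers of x with exponent below N form a basis, stated through evaluation
    of polynomials at x because the proofs lift elements of A to K[X]. *)
Definition power_basis (K : fieldType) (A : algType K) (x : A) (N : nat) : Prop :=
  (forall y : A, exists p, y = horner_alg x p) /\
  (forall p : {poly K}, (size p <= N)%N -> horner_alg x p = 0 -> p = 0).

Lemma power_basis_comm (K : fieldType) (A : algType K) (x : A) (N : nat) (y z : A) :
  power_basis x N -> y * z = z * y.
Proof.
by case=> surj _; have [p ->] := surj y; have [q ->] := surj z; rewrite -!rmorphM mulrC.
Qed.

(** The mean lifts to a polynomial of degree below N' * M whose constant term is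
    the inverse of M. *)
Lemma mean_powers_neq0 (K : fieldType) (A : algType K) (x : A) (N' M : nat) (c : K) :
    power_basis x (N' * M) -> (0 < N')%N -> M%:R != 0 :> K ->
  mean_powers M (c *: x ^+ N') != 0.
Proof.
move=> [_ x_free] N'_gt0 M_neq0; pose e := mean_powers M (c *: 'X^N' : {poly K}).
have M_gt0 : (0 < M)%N by case: M M_neq0 {e x_free}; rewrite ?eqxx.
have -> : mean_powers M (c *: x ^+ N') = horner_alg x e.
  rewrite /e /mean_powers linearZ /= mulr_algl rmorph_sum.
  congr (_ *: _); apply: eq_bigr => j _.
  by rewrite rmorphXn /= linearZ /= mulr_algl rmorphXn /= horner_algX.
apply/eqP => /x_free e0; have : e.[0] = M%:R^-1.
  rewrite hornerZ horner_sum (bigD1 (Ordinal M_gt0)) //= hornerE big1 => [|j].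
    by rewrite addr0 mulr1.
  rewrite -val_eqE /= -lt0n => j_gt0.
  by rewrite !hornerE expr0n gtn_eqF // mulr0 expr0n gtn_eqF.
rewrite e0 ?horner0; last first.
  apply: leq_trans (size_scale_leq _ _) _; apply: leq_trans (size_sum _ _ _) _.
  apply/bigmax_leqP => j _; rewrite exprZn -exprM.
  by apply: leq_trans (size_scale_leq _ _) _; rewrite size_polyXn ltn_pmul2l.
by move/esym/eqP; rewrite invr_eq0 (negPf M_neq0).
Qed.

(** The ideal generated by the mean e is a quotient of the field
    K[X] / (X^N' - c), because X^N' - c annihilates e at x.  Let e = f + h with f
    the value of p at x.  If X^N' - c divides p then f = f e = 0.  Otherwise a
    Bezout relation gives an inverse of f in the ideal, and f h = 0 yields
    h = 0. *)
Lemma mean_powers_minimal (K : fieldType) (A : algType K) (x : A) (N' M : nat) (c : K) :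
    power_basis x (N' * M) -> (0 < N')%N -> M%:R != 0 :> K -> c != 0 ->
    x ^+ (N' * M) = (c ^+ M)%:A -> irreducible_poly ('X^N' - c%:P) ->
  minimal_idempotent (mean_powers M (c^-1 *: x ^+ N')).
Proof.
move=> x_basis N'_gt0 M_neq0 c_neq0 xN P_irr.
have mulC y z : y * z = z * y := power_basis_comm y z x_basis.
set u := c^-1 *: x ^+ N'; set e := mean_powers M u.
have uM : u ^+ M = 1.
  by rewrite /u exprZn -exprM xN scalerA exprVn mulVf ?expf_neq0 // scale1r.
have P_e : horner_alg x ('X^N' - c%:P) * e = 0.
  have -> : horner_alg x ('X^N' - c%:P) = c *: (u - 1).
    rewrite rmorphB rmorphXn /= horner_algX horner_algC.
    by rewrite scalerBr scalerA divff // scale1r.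
  by rewrite -scalerAl mulrBl mul1r mulr_mean_powers // subrr scaler0.
split; [exact: mean_powers_idem | exact: mean_powers_neq0 |].
case=> f [h [[ff hh] [f0 h0] [fh hf] eE]].
have fe : f * e = f by rewrite eE mulrDr ff fh addr0.
have [p fE] := x_basis.1 f.
have kill q : 'X^N' - c%:P %| q -> horner_alg x q * e = 0.
  by case/dvdpP=> r ->; rewrite rmorphM -mulrA P_e mulr0.
have [/kill|ndvd] := boolP ('X^N' - c%:P %| p).
  by rewrite -fE fe => /eqP; rewrite (negPf f0).
have /Bezout_eq1_coprimepP[[r t] /= rtE] : coprimep ('X^N' - c%:P) p.
  by rewrite irreducible_poly_coprime.
have eE' : e = horner_alg x t * f.
  rewrite -[LHS]mul1r -[1](rmorph1 (horner_alg x)) -rtE rmorphD !rmorphM.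
  by rewrite /= mulrDl -!mulrA P_e mulr0 add0r -fE fe.
have : h * e = h by rewrite eE mulrDr hf hh add0r.
by rewrite eE' [_ * f]mulC mulrA hf mul0r => h00; rewrite -h00 eqxx in h0.
Qed.

(** If e is minimal then e (F i) is nonzero for some i; the decompositions of e
    and of F i along their product are trivial, so both are equal to it. *)
Lemma minimal_idempotentsE (A : nzRingType) (I : finType) (F : I -> A) :
    (forall y z : A, y * z = z * y) ->
    (forall i, minimal_idempotent (F i)) -> \sum_i F i = 1 ->
  forall e : A, minimal_idempotent e <-> exists i, e = F i.
Proof.
move=> mulC F_min sumF e; split=> [[ee e0 e_min]|[i ->]]; last exact: F_min.
have absorb (x y : A) :
    minimal_idempotent x -> Defs.idempotent y -> x * y != 0 -> x = x * y.
  case=> xx x0 x_min yy xy0; apply/eqP/idPn => xNxy; apply: x_min.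
  exists (x * y), (x - x * y).
  have xyxy : x * y * (x * y) = x * y.
    by rewrite mulrA -(mulrA x) (mulC y) mulrA xx -mulrA yy.
  have xxy : x * (x * y) = x * y by rewrite mulrA xx.
  have xyx : x * y * x = x * y by rewrite mulC.
  split; rewrite ?subr_eq0 //.
  - by rewrite /Defs.idempotent mulrBl !mulrBr xx xyx xxy xyxy subrr subr0.
  - by rewrite mulrBl mulrBr xyx xxy xyxy subrr.
  - by rewrite addrC subrK.
have [i eF0] : exists i, e * F i != 0.
  apply/existsP; rewrite -[[exists _, _]]negbK negb_exists; apply/negP => /forallP eF0.
  case/negP: e0; rewrite -[e]mulr1 -sumF mulr_sumr big1 // => i _.
  by apply/eqP; rewrite -[_ == _]negbK.
have [Fi_idem _ _] := F_min i.
exists i; rewrite (absorb e (F i)) // [RHS](absorb (F i) e) // 1?mulC //.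
Qed.

Lemma mean_powers1 (K : fieldType) (A : algType K) (u : A) :
  mean_powers 1 u = 1.
Proof. by rewrite /mean_powers big_ord1 expr0 invr1 scale1r. Qed.

(** Case M = 2 of [sum_mean_powers]: the means of u and of - u add up to the mean
    of half as many powers of u^2.  Iterating t times leaves a single power, u^0. *)
Lemma sum_mean_powers_tower (K : fieldType) (A : algType K) (t : nat) (u : A) :
    2.-primitive_root (-1 : K) ->
  mean_powers (2 ^ t) u
    + \sum_(r < t) mean_powers (2 ^ (t - r)) (- u ^+ (2 ^ r)) = 1.
Proof.
move=> prim2; elim: t u => [|t IHt] u; first by rewrite big_ord0 addr0 mean_powers1.
rewrite big_ord_recl /= subn0 expn0 expr1 addrA -[RHS](IHt (u ^+ 2)).
congr (_ + _); last first.
  by apply: eq_bigr => r _; rewrite /bump /= add1n subSS expnS exprM.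
have := sum_mean_powers (2 ^ t) u prim2; rewrite -expnS => <-.
by rewrite !big_ord_recl big_ord0 addr0 /= expr0 expr1 invr1 scale1r invrN1 scaleN1r.
Qed.

Lemma root_mean_minimal (K : fieldType) (A : algType K) (x : A) (w c : K) (k l n : nat) :
    n = (k + l)%N -> power_basis x (2 ^ n) -> 2%:R != 0 :> K -> w ^+ 2 = -1 ->
    c != 0 -> x ^+ (2 ^ n) = (c ^+ (2 ^ l))%:A ->
    ((0 < k)%N -> forall d, c != d ^+ 2) ->
  minimal_idempotent (mean_powers (2 ^ l) (c^-1 *: x ^+ (2 ^ k))).
Proof.
move=> -> x_basis two_neq0 w2 c_neq0 xN c_nsq; rewrite expnD in x_basis xN.
apply: mean_powers_minimal => //; first by rewrite expn_gt0.
  by rewrite natrX expf_neq0.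
exact: irreducible_Xn2subC w2 c_nsq.
Qed.

(** * Constants that are not squares *)

Lemma prim_root_half (F : fieldType) (z : F) (k : nat) :
  (2 ^ k.+1).-primitive_root z -> z ^+ (2 ^ k) = -1.
Proof.
move=> z_prim; have /eqP := prim_expr_order z_prim.
rewrite expnSr exprM sqrf_eq1 -(prim_order_dvd z_prim) => /orP[|/eqP//].
by rewrite dvdn_Pexp2l // ltnn.
Qed.

Lemma in_base_le (K : fieldType) (Kbar : closedFieldType)
    (iota : {rmorphism K -> Kbar}) (eps : nat -> Kbar) (j k : nat) :
  eps_system eps -> (j <= k)%N -> in_base iota (eps k) -> in_base iota (eps j).
Proof.
move=> eps_prim le_jk [z zE]; have := exp_prim_root (eps_prim k) (2 ^ (k - j)).
have dvd_jk : (2 ^ (k - j) %| 2 ^ k)%N by rewrite dvdn_exp2l ?leq_subr.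
rewrite (gcdn_idPl dvd_jk) -expnB ?leq_subr // subKn // => prim.
have [i ->] := prim_rootP prim (prim_expr_order (eps_prim j)).
by exists ((z ^+ (2 ^ (k - j))) ^+ i); rewrite !rmorphXn /= zE.
Qed.

Lemma height_root_nonsquare (K : fieldType) (Kbar : closedFieldType)
    (iota : {rmorphism K -> Kbar}) (eps : nat -> Kbar)
    (n : nat) (a : K) (s : nat) (c : K) :
    base_eq_adjoin2 iota eps -> is_height iota eps n a s -> (s < n)%N ->
    c ^+ (2 ^ s) = a -> forall d, c != d ^+ 2.
Proof.
move=> base_adj [_ [a0 _] s_max] ltsn cE d; apply/eqP => cd.
have : (s.+1 <= s)%N; last by rewrite ltnn.
have aE : a = d ^+ (2 ^ s.+1) by rewrite expnS exprM -cd.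
apply: s_max => //; split=> //; exists (iota d); split.
- by apply/base_adj; exists d.
- by rewrite fmorph_eq0; apply: contra a0 => /eqP d0; rewrite aE d0 expr0n expn_eq0.
- by rewrite aE rmorphXn.
Qed.

Lemma two_neq0 (K : fieldType) (Kbar : closedFieldType)
    (iota : {rmorphism K -> Kbar}) (eps : nat -> Kbar) :
  eps_system eps -> 2%:R != 0 :> K.
Proof.
move=> eps_prim; have := prim_root_natf_neq0 (eps_prim 1).
by rewrite -(rmorph_nat iota) fmorph_eq0.
Qed.

Lemma primitive_N1 (K : fieldType) (Kbar : closedFieldType)
    (iota : {rmorphism K -> Kbar}) (eps : nat -> Kbar) :
  eps_system eps -> 2.-primitive_root (-1 : K).
Proof.
move=> eps_prim; rewrite -(fmorph_primitive_root iota) rmorphN1.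
rewrite -(prim_root_half (eps_prim 1)).
by rewrite expr1; exact: (eps_prim 1).
Qed.

(** A square root d of z has order 2^(k+2), so the root of unity outside K would
    be a power of d. *)
Lemma base_root_nonsquare (K : fieldType) (Kbar : closedFieldType)
    (iota : {rmorphism K -> Kbar}) (eps : nat -> Kbar) (k : nat) (z : K) :
    eps_system eps ->
  ~ in_base iota (eps k.+2) -> z ^+ (2 ^ k) = -1 -> forall d, z != d ^+ 2.
Proof.
move=> eps_prim not_base zE d; apply/eqP => zd; apply: not_base.
have dE : iota d ^+ (2 ^ k.+1) = -1.
  by rewrite -rmorphXn expnS exprM -zd zE rmorphN1.
have d1 : iota d ^+ (2 ^ k.+2) = 1 by rewrite expnSr exprM dE sqrrN expr1n.
have prim := eps_prim k.+2.
have [i diE] := prim_rootP prim d1.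
have i_odd : odd i.
  apply/negPn/negP => i_even.
  have : iota d ^+ (2 ^ k.+1) = 1.
    rewrite diE -exprM -[i : nat]odd_double_half (negPf i_even) add0n -mul2n.
    by rewrite mulnAC -expnS exprM (prim_expr_order prim) expr1n.
  move/eqP; rewrite dE eq_sym -subr_eq0 opprK -mulr2n -(rmorph_nat iota).
  by rewrite fmorph_eq0 (negPf (two_neq0 iota eps_prim)).
have d_prim : (2 ^ k.+2).-primitive_root (iota d).
  by rewrite diE prim_root_exp_coprime // coprimeXr // coprimen2.
have [j ->] := prim_rootP d_prim (prim_expr_order prim).
by exists (d ^+ j); rewrite rmorphXn.
Qed.

Lemma base_sqrtN1 (K : fieldType) (Kbar : closedFieldType)
    (iota : {rmorphism K -> Kbar}) (eps : nat -> Kbar) :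
  eps_system eps -> base_eq_adjoin2 iota eps -> exists w : K, w ^+ 2 = -1.
Proof.
move=> eps_prim; case/(_ (eps 2)) => _ [S _ _ //|w wE].
exists w; apply: (fmorph_inj iota).
by rewrite rmorphXn /= wE rmorphN1 -(prim_root_half (eps_prim 2)).
Qed.

(** * The basis of powers *)

(** The power x^i of the generator is a nonzero multiple of the basis element at
    g^i for i > 0; that at 1 is reached through i = N, where the power of x is a
    scalar.  So the N powers span a space of dimension N. *)
Lemma tga_power_basis (K : fieldType) (gT : finGroupType) (G : {group gT}) (g : gT)
    (A : falgType K) (bar : gT -> A) (gamma : gT -> gT -> K) (a : K) :
    G = <[g]>%g :> {set gT} -> is_twisted_group_algebra G bar gamma ->
    bar g ^+ #|G| = a%:A ->
  power_basis (bar g) #|G|.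
Proof.
move=> GE [bar_basis gamma0 barM] gN; set N := #|G| in gN *.
have gG i : (g ^+ i)%g \in G by rewrite GE mem_cycle.
have gNE : (g ^+ N)%g = 1%g by rewrite /N GE expg_order.
have pow i : exists2 k, k != 0 & bar g ^+ i.+1 = k *: bar (g ^+ i.+1)%g.
  elim: i => [|i [k k0 IHi]]; first by exists 1; rewrite ?oner_eq0 // scale1r expr1.
  have g1 := gG 1%N; rewrite expg1 in g1.
  exists (gamma g (g ^+ i.+1)%g * k); first by rewrite mulf_neq0 // gamma0.
  by rewrite exprS IHi -scalerAr barM // scalerA mulrC -expgS.
pose X := [tuple bar g ^+ i | i < N].
have X_full : (fullv <= <<X>>)%VS.
  rewrite -(span_basis bar_basis); apply/span_subvP => _ /imageP[y Gy ->].
  rewrite GE in Gy; case/cyclePmin: Gy => i lt_iN ->.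
  have X_pow j : (j < N)%N -> bar g ^+ j \in <<X>>%VS.
    move=> ltj; apply: memv_span; apply/imageP; by exists (Ordinal ltj).
  rewrite orderE -GE -/N in lt_iN.
  case: i lt_iN => [|i] lt_iN.
    have := pow N.-1; rewrite (prednK lt_iN) gN gNE => -[k k0 kE].
    rewrite expg0; have -> : bar 1%g = (k^-1 * a) *: bar g ^+ 0.
      by rewrite -scalerA kE scalerA mulVf // scale1r.
    exact/memvZ/X_pow.
  have [k k0 kE] := pow i; have -> : bar (g ^+ i.+1)%g = k^-1 *: bar g ^+ i.+1.
    by rewrite kE scalerA mulVf // scale1r.
  exact/memvZ/X_pow.
have X_basis : basis_of fullv X.
  rewrite basisEdim X_full size_tuple.
  have := size_basis bar_basis.
  by move=> ->; rewrite leqnn.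
have ev_sum (c : nat -> K) :
    horner_alg (bar g) (\poly_(i < N) c i) = \sum_(i < N) c i *: X`_i.
  rewrite poly_def rmorph_sum; apply: eq_bigr => i _.
  rewrite -tnth_nth tnth_mktuple /= linearZ /= mulr_algl rmorphXn /=.
  by rewrite horner_algX.
split=> [y|p le_pN].
  have /coord_span -> : y \in <<X>>%VS by apply: (subvP X_full); rewrite memvf.
  exists (\poly_(i < N) oapp (fun i => coord X i y) 0 (insub i)).
  by rewrite ev_sum; apply: eq_bigr => i _; rewrite valK.
have pE : p = \poly_(i < N) p`_i.
  apply/polyP => i; rewrite coef_poly; case: ltnP => // /(leq_trans le_pN).
  by move/leq_sizeP->.
rewrite pE ev_sum => /(elimT freeP (basis_free X_basis) (fun i => p`_i)) p0.
apply/polyP=> i; rewrite coef_poly coef0; case: ltnP => // lt_i.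
by rewrite (p0 (Ordinal lt_i)).
Qed.

(** * Minimal idempotents *)

Theorem theorem2
    (K : fieldType) (Kbar : closedFieldType) (iota : {rmorphism K -> Kbar})
    (Kbar_alg : algebraic_over iota)
    (eps : nat -> Kbar) (eps_prim : eps_system eps)
    (charK : 2%N \notin [pchar K])
    (K_eps2 : base_eq_adjoin2 iota eps)
    (gT : finGroupType) (G : {group gT}) (g : gT) (n : nat)
    (G_cyclic : G = <[g]>%g :> {set gT}) (G_order : #|G| = (2 ^ n)%N)
    (KtG : falgType K) (bar : gT -> KtG) (gamma : gT -> gT -> K)
    (KtG_tga : is_twisted_group_algebra G bar gamma)
    (a : K) (a_neq0 : a != 0) (bar_g : bar g ^+ (2 ^ n) = a%:A)
    (s : nat) (height_a : is_height iota eps n a s)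
    (b : K) (b_neq0 : b != 0) (a_eq : a = b ^+ (2 ^ s)) :
  ((type_A iota eps \/ exists2 m : nat, type_B iota eps m & (s <= m)%N) ->
   exists2 zs : K, iota zs = eps s &
   forall e : KtG, minimal_idempotent e <->
     exists i : 'I_(2 ^ s),
       e = (2 ^ s)%:R^-1 *:
           \sum_(j < 2 ^ s) ((b^-1 * zs ^- i) *: bar g ^+ (2 ^ (n - s))) ^+ j)
  /\
  (forall m : nat, type_B iota eps m -> (m < s <= n)%N ->
   exists zm zm1 : K,
   [/\ iota zm = eps m, iota zm1 = eps m.-1 &
   forall e : KtG, minimal_idempotent e <->
     (exists i : 'I_(2 ^ m),
        e = (2 ^ s)%:R^-1 *:
            \sum_(j < 2 ^ s) ((b^-1 * zm ^- i) *: bar g ^+ (2 ^ (n - s))) ^+ j)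
     \/
     (exists r : nat, exists i : 'I_(2 ^ m.-1),
        (1 <= r <= s - m)%N /\
        e = (2 ^ (s - r))%:R^-1 *:
            \sum_(j < 2 ^ (s - r))
              ((b ^- (2 ^ r) * zm^-1 * zm1 ^- i) *:
                 bar g ^+ (2 ^ (n - s + r))) ^+ j)]).
Proof.
have KtG_pow : power_basis (bar g) (2 ^ n).
  rewrite -G_order; apply: (tga_power_basis G_cyclic KtG_tga (a := a)).
  by rewrite G_order.
have mulC y z : y * z = z * y := power_basis_comm y z KtG_pow.
have two0 : 2%:R != 0 :> K := two_neq0 iota eps_prim.
have [w w2] := base_sqrtN1 eps_prim K_eps2.
have [le_sn _ _] := height_a.
have component k l (c : K) : n = (k + l)%N -> c ^+ (2 ^ l) = a ->
    ((0 < k)%N -> forall d, c != d ^+ 2) ->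
    minimal_idempotent (mean_powers (2 ^ l) (c^-1 *: bar g ^+ (2 ^ k))).
  move=> nE cE; apply: (root_mean_minimal nE KtG_pow two0 w2); last by rewrite cE.
  by apply: contra a_neq0 => /eqP c0; rewrite -cE c0 expr0n expn_eq0.
have component_s c : c ^+ (2 ^ s) = a ->
    minimal_idempotent (mean_powers (2 ^ s) (c^-1 *: bar g ^+ (2 ^ (n - s)))).
  move=> cE; apply: (component _ _ _ _ cE); first by rewrite subnK.
  rewrite subn_gt0 => lt_sn.
  exact: (height_root_nonsquare K_eps2 height_a lt_sn cE).
set u := b^-1 *: bar g ^+ (2 ^ (n - s)).
split=> [types|m [m_ge2 [zm zmE] not_base] /andP[lt_ms _]].
  have [zs zsE] : in_base iota (eps s).
    case: types => [|[m [_ base_m _] le_sm]]; first exact.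
    exact: in_base_le le_sm base_m.
  have zs_prim : (2 ^ s).-primitive_root zs.
    by rewrite -(fmorph_primitive_root iota) zsE.
  exists zs => // e; pose F (i : 'I_(2 ^ s)) := mean_powers (2 ^ s) (zs ^- i *: u).
  have F_E i : F i = mean_powers (2 ^ s) ((b^-1 * zs ^- i) *: bar g ^+ (2 ^ (n - s))).
    by rewrite /F scalerA mulrC.
  apply: iff_trans (minimal_idempotentsE (F := F) mulC _ _ e) _.
  - move=> i; rewrite F_E -invfM; apply: component_s.
    by rewrite exprMn -exprM mulnC exprM (prim_expr_order zs_prim) expr1n mulr1 -a_eq.
  - have := sum_mean_powers 1 u zs_prim; rewrite muln1 => ->.
    exact: mean_powers1.
  by split=> -[i ->]; exists i; rewrite F_E.
(* From here on the constant of K is m.+1. *)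
case: m m_ge2 zm zmE not_base lt_ms => // m m_gt0 zm zmE not_base lt_ms.
have [zm1 zm1E] : in_base iota (eps m).
  by apply: (in_base_le eps_prim (leqnSn m)); exists zm.
have zm_prim : (2 ^ m.+1).-primitive_root zm.
  by rewrite -(fmorph_primitive_root iota) zmE.
have zm1_prim : (2 ^ m).-primitive_root zm1.
  by rewrite -(fmorph_primitive_root iota) zm1E.
exists zm, zm1; split=> //= e.
(* Here r starts from 0, so it stands for the r.+1 of the statement. *)
pose F (j : 'I_(2 ^ m.+1) + 'I_(s - m.+1) * 'I_(2 ^ m)) : KtG := match j with
  | inl i => mean_powers (2 ^ s) (zm ^- i *: u)
  | inr (r, i) => mean_powers (2 ^ (s - r.+1)) (zm1 ^- i *: (zm^-1 *: u ^+ (2 ^ r.+1)))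
  end.
have F_l i : F (inl i) =
    mean_powers (2 ^ s) ((b^-1 * zm ^- i) *: bar g ^+ (2 ^ (n - s))).
  by rewrite /F scalerA mulrC.
have F_r r i : F (inr (r, i)) = mean_powers (2 ^ (s - r.+1))
    ((b ^- (2 ^ r.+1) * zm^-1 * zm1 ^- i) *: bar g ^+ (2 ^ (n - s + r.+1))).
  rewrite /F /u exprZn -exprM -expnD !scalerA exprVn; congr (mean_powers _ (_ *: _)).
  by rewrite mulrC -[RHS]mulrA [zm ^-1 * _]mulrC.
apply: iff_trans (minimal_idempotentsE (F := F) mulC _ _ e) _.
- case=> [i|[r i]]; rewrite ?F_l ?F_r -?invfM.
    apply: component_s; rewrite exprMn -a_eq -exprM mulnC exprM.
    have /dvdnP[q ->] : (2 ^ m.+1 %| 2 ^ s)%N by rewrite dvdn_exp2l // ltnW.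
    by rewrite mulnC exprM (prim_expr_order zm_prim) expr1n expr1n mulr1.
  have lt_r : (r < s - m.+1)%N by [].
  have zzE : (zm * zm1 ^+ i) ^+ (2 ^ m) = -1.
    rewrite exprMn (prim_root_half zm_prim) -exprM mulnC exprM.
    by rewrite (prim_expr_order zm1_prim) expr1n mulr1.
  apply: component.
  + by rewrite -addnA subnKC ?subnK //; lia.
  + rewrite -mulrA exprMn -exprM -expnD subnKC; last by lia.
    rewrite -a_eq (_ : s - r.+1 = m + (s - r.+1 - m.+1).+1)%N; last by lia.
    by rewrite expnD exprM zzE expnS exprM sqrrN !expr1n mulr1.
  move=> _ d; apply/eqP=> dE.
  have /eqP[] := base_root_nonsquare eps_prim not_base zzE (d / b ^+ (2 ^ r)).
  rewrite expr_div_n -dE -exprM -expnSr -mulrA [RHS]mulrC mulKf //.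
  by rewrite expf_neq0.
- rewrite big_sumType /=; have le_ms := ltnW lt_ms.
  have -> : (2 ^ s = 2 ^ m.+1 * 2 ^ (s - m.+1))%N by rewrite -expnD subnKC.
  rewrite sum_mean_powers //.
  have := sum_mean_powers_tower (s - m.+1) (u ^+ (2 ^ m.+1))
    (primitive_N1 iota eps_prim).
  move=> <-.
  congr (_ + _).
  transitivity (\sum_(r < s - m.+1) \sum_(i < 2 ^ m) F (inr (r, i))).
    by rewrite pair_bigA; apply: eq_bigr => -[r i].
  apply: eq_bigr => r _; have lt_r : (r < s - m.+1)%N by [].
  rewrite /F (_ : 2 ^ (s - r.+1) = 2 ^ m * 2 ^ (s - m.+1 - r))%N; last first.
    by rewrite -expnD; congr (2 ^ _)%N; lia.
  rewrite sum_mean_powers // exprZn exprVn (prim_root_half zm_prim) invrN1 scaleN1r.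
  by rewrite -!exprM -!expnD addSnnS addnC.
split=> [[[i|[r i]] ->]|[[i ->]|[r [i [/andP[r_gt0 r_le] ->]]]]].
- by left; exists i; rewrite F_l.
- by right; exists r.+1, i; rewrite F_r ltn_ord.
- by exists (inl i); rewrite F_l.
case: r r_gt0 r_le => // r _ r_le.
by exists (inr (Ordinal r_le, i)); rewrite F_r.
Qed.
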